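(* For $n\ge 3$, the alternating sign matrix polytope $ASM_n$ has exactly $4[(n-2)^2+1]$ facets.
   Context: An alternating sign matrix (ASM) is a square matrix with entries in $\{0,1,-1\}$ such that the entries of each row and each column sum to $1$, and the nonzero entries in each row and each column alternate in sign. $ASM_n$ is the convex hull in $\mathbb{R}^{n^2}$ of the $n\times n$ alternating sign matrices. A facet is a face of dimension one less than the dimension of the polytope. *)

(* Defs.v *)
From HB Require Import structures.
From mathcomp Require Import all_boot all_order all_algebra.
From mathcomp Require Import boolp classical_sets functions cardinality reals.

Set Implicit Arguments.
Unset Strict Implicit.
Unset Printing Implicit Defensive.

Import Order.TTheory GRing.Theory Num.Theory.

Local Open Scope classical_set_scope.
Local Open Scope ring_scope.

Section Polytopes.
Variables (R : realType) (V : vectType R).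
Implicit Types S P F : set V.

Definition convex_hull S : set V :=
  [set x | exists (k : nat) (w : 'I_k -> R) (p : 'I_k -> V),
    [/\ forall i, 0 <= w i, \sum_i w i = 1, forall i, S (p i)
      & x = \sum_i w i *: p i]].

Definition affine_hull S : set V :=
  [set x | exists (k : nat) (w : 'I_k -> R) (p : 'I_k -> V),
    [/\ \sum_i w i = 1, forall i, S (p i) & x = \sum_i w i *: p i]].

(* The dimension of a set is that of its affine hull, which for a nonempty set
   is a translate of a linear subspace; the empty set has dimension -1. *)
Definition has_dim S (d : int) : Prop :=
  (S = set0 /\ d = - 1) \/
  (exists (x : V) (U : {vspace V}),
     affine_hull S = [set x + u | u in [set u : V | u \in U]] /\ d = (\dim U)%:Z).

(* f = 0 yields P itself and the empty set, which count as faces. *)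
Definition is_face P F : Prop :=
  exists (f : {scalar V}) (c : R),
    (forall x, P x -> f x <= c) /\ F = P `&` [set x | f x = c].

Definition is_facet P F : Prop :=
  is_face P F /\ exists d : int, has_dim F d /\ has_dim P (d + 1).

End Polytopes.

Section ASM.
Variables (R : realType) (n : nat).

Definition alternates (f : 'I_n -> R) : Prop :=
  forall j k : 'I_n, (j < k)%N -> f j != 0 -> f k != 0 ->
    (forall l : 'I_n, (j < l < k)%N -> f l = 0) ->
    Num.sg (f k) = - Num.sg (f j).

Definition is_asm (A : 'M[R]_n) : Prop :=
  [/\ forall i j, A i j \in [:: 0; 1; -1],
      forall i, \sum_j A i j = 1,
      forall j, \sum_i A i j = 1,
      forall i, alternates (fun j => A i j)
    & forall j, alternates (fun i => A i j)].

Definition asm_polytope : set 'M[R]_n := convex_hull [set A | is_asm A].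

End ASM.

Arguments asm_polytope R n : clear implicits.

(* Main.v *)
Require Import Defs.
From HB Require Import structures.
From mathcomp Require Import all_boot all_order all_algebra.
From mathcomp Require Import boolp classical_sets functions cardinality reals.
From mathcomp Require Import zify ring lra.

Set Implicit Arguments.
Unset Strict Implicit.
Unset Printing Implicit Defensive.

Import Order.TTheory GRing.Theory Num.Theory.

Local Open Scope classical_set_scope.
Local Open Scope ring_scope.

(** Let [C i j] be the sum of the entries of [A] in its first [i] rows and [j]
    columns. A matrix with unit row and column sums is an ASM iff [C] is integral
    and neighbouring values of [C] differ by 0 or 1. Rounding real values down, after
    a common shift, preserves all integral upper bounds on their differences; so if
    neighbouring values of [C] differ by a real in [0, 1], averaging the roundings
    [floor (C i j + t)] over the shifts [t] exhibits [A] as an average of ASMs. Hence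
    the polytope is cut out, within the matrices with unit sums, by requiring that
    every initial segment of a line, read from any of the four borders, has a
    nonnegative sum.

    Up to rotation by a quarter turn, all these inequalities follow from those for
    the top left entry and for the top [i] entries of an inner column, with
    [1 <= i <= n - 2]: that is [1 + (n - 2)^2] inequalities on each of the four
    sides. The uniform matrix satisfies them all strictly, and each of them is
    violated by a matrix with unit sums that satisfies all the others; so none is
    redundant, and they correspond bijectively to the facets. *)

Section ScalarKernel.
Variables (F : fieldType) (V : vectType F) (f : {scalar V}).

(* [lker] only applies to maps between vector spaces, so [f] is retyped with
   values in the regular module of [F]. *)
Let scalar_to_regular (x : V) : F^o := f x.

Fact scalar_to_regular_is_linear : linear scalar_to_regular.
Proof. by move=> a u v; rewrite /scalar_to_regular linearP. Qed.

HB.instance Definition _ :=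
  GRing.isLinear.Build F V F^o *:%R scalar_to_regular scalar_to_regular_is_linear.

Definition scalar_ker : {vspace V} := lker (linfun scalar_to_regular).

Lemma mem_scalar_ker u : (u \in scalar_ker) = (f u == 0).
Proof. by rewrite memv_ker lfunE. Qed.

Lemma dim_cap_scalar_ker (U : {vspace V}) u :
  u \in U -> f u != 0 -> \dim U = (\dim (U :&: scalar_ker)).+1.
Proof.
move=> Uu fu; rewrite -(limg_ker_dim (linfun scalar_to_regular) U) -addn1.
congr addn; apply/eqP; rewrite eqn_leq; apply/andP; split.
  by rewrite (leq_trans (dimvS (subvf _))) // dimvf.
rewrite lt0n dimv_eq0; apply: contra fu => /eqP img0.
by have := memv_img (linfun scalar_to_regular) Uu; rewrite img0 memv0 lfunE.
Qed.

End ScalarKernel.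

Section ConvexHull.
Variable R : realType.
Implicit Types V W : vectType R.

Lemma subset_convex_hull V (S : set V) : S `<=` convex_hull S.
Proof.
move=> x Sx; exists 1%N, (fun=> 1), (fun=> x).
by split=> // [|]; rewrite big_ord_recl big_ord0 addr0 // scale1r.
Qed.

Lemma convex_hull_convex V (S : set V) (t : R) x y : 0 <= t <= 1 ->
  convex_hull S x -> convex_hull S y -> convex_hull S (t *: x + (1 - t) *: y).
Proof.
move=> /andP[t0 t1] [k [w [p [w0 w1 Sp ->]]]] [k' [w' [p' [w0' w1' Sp' ->]]]].
pose glue T (g : 'I_k -> T) (g' : 'I_k' -> T) (i : 'I_(k + k')) :=
  match fintype.split i with inl a => g a | inr a => g' a end.
have sum_glue (M : nmodType) T (h : T -> M) g g' :
    \sum_i h (glue T g g' i) = \sum_i h (g i) + \sum_i h (g' i).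
  rewrite big_split_ord; congr (_ + _); apply: eq_bigr => i _.
    by rewrite /glue (unsplitK (inl i)).
  by rewrite /glue (unsplitK (inr i)).
pose c := glue _ (fun i => (t * w i, p i)) (fun i => ((1 - t) * w' i, p' i)).
exists (k + k')%N, (fst \o c), (snd \o c); split => [i||i|].
- by rewrite /= /c /glue; case: fintype.split => a; rewrite mulr_ge0 // subr_ge0.
- by rewrite (sum_glue _ _ fst) /= -!mulr_sumr w1 w1' !mulr1 addrC subrK.
- by rewrite /= /c /glue; case: fintype.split.
- rewrite (sum_glue _ _ (fun q => q.1 *: q.2)) /= !scaler_sumr.
  by congr (_ + _); apply: eq_bigr => i _; rewrite scalerA.
Qed.

Lemma convex_hull_image V W (S : set V) (T : set W) (f : {linear V -> W}) x :
  (forall y, S y -> T (f y)) -> convex_hull S x -> convex_hull T (f x).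
Proof.
move=> ST [k [w [p [w0 w1 Sp ->]]]]; exists k, w, (f \o p); split=> // [i|].
  exact: ST.
by rewrite linear_sum; apply: eq_bigr => i _; rewrite linearZ.
Qed.

Lemma convex_hull_affine V (S : set V) : convex_hull S `<=` affine_hull S.
Proof. by move=> x [k [w [p [_ w1 Sp ->]]]]; exists k, w, p. Qed.

End ConvexHull.

Section AffineHull.
Variables (R : realType) (V : vectType R).
Implicit Types (S T P F G : set V) (x y : V) (U W : {vspace V}) (d : int).

Lemma subset_affine_hull S : S `<=` affine_hull S.
Proof. by move=> x Sx; apply/convex_hull_affine/subset_convex_hull. Qed.

Lemma affine_hullS S T : S `<=` T -> affine_hull S `<=` affine_hull T.
Proof.
move=> sST x [k [w [p [w1 Sp ->]]]].
by exists k, w, p; split=> // i; apply: sST.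
Qed.

Lemma affine_hull_level S (f : {scalar V}) (c : R) :
  S `<=` [set x | f x = c] -> affine_hull S `<=` [set x | f x = c].
Proof.
move=> Sc x [k [w [p [w1 Sp ->]]]] /=; rewrite linear_sum /=.
under eq_bigr do rewrite linearZ /= Sc //.
by rewrite -mulr_suml w1 mul1r.
Qed.

Lemma affine_hull0 : affine_hull (set0 : set V) = set0.
Proof.
apply/seteqP; split=> // x [[|k] [w [p [w1 Sp _]]]]; last exact: Sp ord0.
by move: w1; rewrite big_ord0 => /eqP; rewrite eq_sym oner_eq0.
Qed.

Definition flat x U : set V := [set x + u | u in [set u : V | u \in U]].

Lemma flatP x U y : flat x U y <-> y - x \in U.
Proof.
split=> [[u /= Uu <-]|Uyx]; first by rewrite addrAC subrr add0r.
by exists (y - x) => //; rewrite addrC subrK.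
Qed.

Lemma flat_refl x U : flat x U x.
Proof. by apply/flatP; rewrite subrr mem0v. Qed.

Lemma affine_hull_flat S x U :
  S `<=` flat x U -> affine_hull S `<=` flat x U.
Proof.
move=> SU y [k [w [p [w1 Sp ->]]]]; apply/flatP.
rewrite -[x]scale1r -w1 scaler_suml -sumrB memv_suml // => i _.
by rewrite -scalerBr memvZ //; apply/flatP/SU.
Qed.

Lemma affine_hull_eq_flat S x U : S x -> S `<=` flat x U ->
    (forall u, u \in U -> exists2 e : R, 0 < e & S (x + e *: u)) ->
  affine_hull S = flat x U.
Proof.
move=> Sx SU US; apply/seteqP; split; first exact: affine_hull_flat.
move=> _ [u /= /US[e e_gt0 Se] <-].
exists 2%N, (fun i => if i == ord0 then 1 - e^-1 else e^-1),
  (fun i => if i == ord0 then x else x + e *: u); split.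
- by rewrite !big_ord_recl big_ord0 /= addr0 subrK.
- by move=> i; case: ifP.
- rewrite !big_ord_recl big_ord0 /= addr0 scalerDr scalerA mulVf ?gt_eqF //.
  by rewrite scale1r addrA -scalerDl subrK scale1r.
Qed.

Lemma flat_subv x y U W : flat x U `<=` flat y W -> (U <= W)%VS.
Proof.
move=> sUW; apply/subvP => u Uu.
have /sUW/flatP Wxu : flat x U (x + u) by exists u.
have /sUW/flatP Wx := flat_refl x U.
have -> : u = x + u - y - (x - y) by rewrite opprB addrA subrK addrAC subrr add0r.
by rewrite memvB.
Qed.

Lemma flat_sub_eq x y U : flat x U `<=` flat y U -> flat x U = flat y U.
Proof.
move=> sUU; apply/seteqP; split=> // z /flatP Uzy; apply/flatP.
have /sUU/flatP Uxy := flat_refl x U.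
have -> : z - x = z - y - (x - y) by rewrite opprB addrA subrK.
by rewrite memvB.
Qed.

Lemma has_dimP S d : has_dim S d <-> (S = set0 /\ d = - 1) \/
  (exists x U, affine_hull S = flat x U /\ d = (\dim U)%:Z).
Proof. by []. Qed.

Lemma has_dim_unique S d d' : has_dim S d -> has_dim S d' -> d = d'.
Proof.
have no_flat x U : affine_hull (set0 : set V) = flat x U -> False.
  by rewrite affine_hull0 => E; have := flat_refl x U; rewrite -E.
move=> /has_dimP[[S0 ->]|[x [U [SU ->]]]] /has_dimP[[S0' ->]|[y [W [SW ->]]]] //.
- by case: (@no_flat y W); rewrite -S0.
- by case: (@no_flat x U); rewrite -S0'.
- have UW : flat x U = flat y W by rewrite -SU -SW.
  suff -> : U = W by [].
  apply/eqP; rewrite eqEsubv; apply/andP.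
  by split; [apply: (@flat_subv x y)|apply: (@flat_subv y x)]; rewrite UW.
Qed.

Lemma affine_hull_eq_dim S T d : S `<=` T ->
  has_dim S d -> has_dim T d -> affine_hull S = affine_hull T.
Proof.
move=> /affine_hullS hST /has_dimP[[S0 dE]|[x [U [SU dE]]]].
  by move=> /has_dimP[[T0 _]|[y [W [_]]]]; [rewrite S0 T0|rewrite dE].
move=> /has_dimP[[_]|[y [W [TW]]]]; rewrite dE // => -[dimUW].
move: hST; rewrite SU TW => sUW; have UW : U = W.
  by apply/eqP; rewrite eqEdim (flat_subv sUW) dimUW leqnn.
by move: sUW; rewrite UW => /flat_sub_eq.
Qed.

Lemma face_eq_dim P F G d : is_face P F -> F `<=` G -> G `<=` P ->
  has_dim F d -> has_dim G d -> F = G.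
Proof.
move=> [f [c [_ FE]]] FG GP dimF dimG; apply/seteqP; split=> // x Gx.
rewrite FE; split; first exact: GP.
apply: (@affine_hull_level F); first by rewrite FE => y [].
by rewrite (affine_hull_eq_dim FG dimF dimG); apply: subset_affine_hull.
Qed.

End AffineHull.

Section Polyhedron.
Variables (R : realType) (V : vectType R) (x0 : V) (U : {vspace V}).
Variables (K : finType) (l : K -> {scalar V}) (b : K -> R).
Implicit Types (x y z u : V) (k : K).

Definition polyhedron : set V := [set x | flat x0 U x /\ forall k, b k <= l k x].

Definition tight_face k : set V := polyhedron `&` [set x | l k x = b k].

Lemma polyhedron_flat x : polyhedron x -> polyhedron `<=` flat x U.
Proof.
move=> [/flatP Ux _] y [/flatP Uy _]; apply/flatP.
have -> : y - x = y - x0 - (x - x0) by rewrite opprB addrA subrK.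
by rewrite memvB.
Qed.

Lemma convex_hull_polyhedron (S : set V) :
  S `<=` polyhedron -> convex_hull S `<=` polyhedron.
Proof.
move=> SP x Sx; split.
  by apply: affine_hull_flat (convex_hull_affine Sx) => y /SP[].
move=> k; case: Sx => n [w [p [w0 w1 Sp ->]]]; rewrite linear_sum /=.
rewrite -[b k]mul1r -w1 mulr_suml; apply: ler_sum => i _.
by rewrite linearZ ler_wpM2l //; have [] := SP _ (Sp i).
Qed.

Lemma polyhedron_shift x u : polyhedron x -> u \in U ->
    (forall k, l k x = b k -> 0 <= l k u) ->
  exists2 e : R, 0 < e & polyhedron (x + e *: u).
Proof.
move=> [/flatP Ux lx] Uu tight_u.
pose step k := if l k u < 0 then (l k x - b k) / - l k u else 1.
have step_gt0 k : 0 < step k.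
  rewrite /step; case: (ltP (l k u)) => // lu.
  rewrite divr_gt0 ?oppr_gt0 // subr_gt0 lt_neqAle lx andbT.
  by apply: contraTneq lu => /esym/tight_u; rewrite leNgt.
pose e := \big[Order.min/1]_k step k.
have e_gt0 : 0 < e by apply: lt_bigmin => // k _.
exists e => //; split; first by apply/flatP; rewrite addrAC memvD // memvZ.
move=> k; have := bigmin_le 1 k step; rewrite -/e /step.
rewrite linearD linearZ /=; case: (ltP (l k u)) => lu e_le.
  have : e * - l k u <= l k x - b k by rewrite -ler_pdivlMr // oppr_gt0.
  by rewrite mulrN; lra.
by rewrite (le_trans (lx k)) // lerDl mulr_ge0 // ltW.
Qed.

Lemma has_dim_interior x : polyhedron x -> (forall k, b k < l k x) ->
  has_dim polyhedron (\dim U)%:Z.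
Proof.
move=> Px lx; right; exists x, U; split=> //.
apply: affine_hull_eq_flat => // [|u Uu]; first exact: polyhedron_flat.
by apply: polyhedron_shift => // k lk; have := lx k; rewrite lk ltxx.
Qed.

Lemma has_dim_tight_face x k : polyhedron x -> l k x = b k ->
    (forall k', k' != k -> b k' < l k' x) ->
  has_dim (tight_face k) (\dim (U :&: scalar_ker (l k)))%:Z.
Proof.
move=> Px lx lx'; right; exists x, (U :&: scalar_ker (l k))%VS; split=> //.
apply: affine_hull_eq_flat => [//|y [Py /= ly]|u].
  apply/flatP; rewrite memv_cap mem_scalar_ker linearB /= ly lx subrr eqxx andbT.
  by apply/flatP/polyhedron_flat.
rewrite memv_cap mem_scalar_ker => /andP[Uu /eqP lu].
have [k' lk'|e e_gt0 Pe] := polyhedron_shift Px Uu.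
  have [->|/lx'] := eqVneq k' k; first by rewrite lu.
  by rewrite lk' ltxx.
by exists e => //; split=> //=; rewrite linearD linearZ /= lu mulr0 addr0.
Qed.

Lemma tight_face_is_face k : is_face polyhedron (tight_face k).
Proof.
exists (\- l k), (- b k); split=> [x [_ lx]|]; first by rewrite /= lerN2.
by apply/seteqP; split=> x [Px /= lx]; split=> //=; [rewrite lx|apply: oppr_inj].
Qed.

Hypothesis K_gt0 : (0 < #|K|)%N.

Lemma exists_interior (S : set V) : S `<=` polyhedron ->
    (forall k, exists2 x, S x & b k < l k x) ->
  exists2 x, convex_hull S x & forall k, b k < l k x.
Proof.
move=> SP slack.
have /choice[x xP] k : exists x, S x /\ b k < l k x.
  by have [x] := slack k; exists x.
pose w : R := #|K|%:R^-1; have w_gt0 : 0 < w by rewrite invr_gt0 ltr0n.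
have sum_w : \sum_(i < #|K|) w = 1.
  by rewrite sumr_const card_ord -[w]mul1r -mulrnAl mulfV // pnatr_eq0 -lt0n.
exists (\sum_(i < #|K|) w *: x (enum_val i)).
  exists #|K|, (fun=> w), (x \o enum_val); split=> // i; first exact: ltW.
  exact: (xP _).1.
move=> k; rewrite linear_sum /= -[b k]mul1r -sum_w mulr_suml.
rewrite (bigD1 (enum_rank k)) // [ltRHS](bigD1 (enum_rank k)) //=.
rewrite ltr_leD ?linearZ ?ler_sum // => [|i _].
  by rewrite /= enum_rankK ltr_pM2l //; apply: (xP k).2.
by rewrite linearZ ler_pM2l //; have [_] := SP _ (xP (enum_val i)).1.
Qed.

Lemma face_eq_interior F x : is_face polyhedron F -> F x ->
  (forall k, b k < l k x) -> F = polyhedron.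
Proof.
move=> [f [c [fc ->]]] [Px /= fx] lx; apply/seteqP; split=> [z []//|z Pz].
split=> //=; apply/eqP; rewrite eq_le fc //= -fx.
have Uxz : x - z \in U by apply/flatP/polyhedron_flat.
have [k lk|e e_gt0 /fc] := polyhedron_shift Px Uxz.
  by have := lx k; rewrite lk ltxx.
by rewrite linearD linearZ linearB /= fx gerDl pmulr_rle0 // subr_le0.
Qed.

Lemma proper_face_sub_tight_face F : is_face polyhedron F -> F <> polyhedron ->
  exists k, F `<=` tight_face k.
Proof.
move=> faceF properF; apply: contrapT => loose; apply: properF.
have [f [c [_ FE]]] := faceF.
have FP : F `<=` polyhedron by rewrite FE => x [].
have [k|x Fx lx] := exists_interior FP.
  apply: contrapT => no_slack; apply: loose; exists k => x Fx.
  split; first exact: FP.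
  have [_ /(_ k)] := FP x Fx; rewrite le_eqVlt => /orP[/eqP//|lx].
  by case: no_slack; exists x.
apply: (face_eq_interior faceF _ lx); rewrite FE; split.
  exact: convex_hull_polyhedron Fx.
by apply: affine_hull_level (convex_hull_affine Fx); rewrite FE => y [].
Qed.

Hypothesis base_interior : forall k, b k < l k x0.
Hypothesis irredundant : forall k,
  exists z, [/\ flat x0 U z, l k z < b k & forall k', k' != k -> b k' <= l k' z].

Lemma polyhedron_base : polyhedron x0.
Proof. by split=> [|k]; [apply: flat_refl|apply: ltW]. Qed.

(* The segment from [x0] to the point violating only the inequality [k] leaves
   the polyhedron through the hyperplane of [k]. *)
Lemma exists_tight_only k : exists x, [/\ polyhedron x, l k x = b k
  & forall k', k' != k -> b k' < l k' x].
Proof.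
have [z [/flatP Uz lz lz']] := irredundant k; have lx0 := base_interior k.
have d_gt0 : 0 < l k x0 - l k z by rewrite subr_gt0 (lt_trans lz).
pose t := (l k x0 - b k) / (l k x0 - l k z).
have t_gt0 : 0 < t by rewrite divr_gt0 // subr_gt0.
have t_lt1 : t < 1 by rewrite ltr_pdivrMr // mul1r ltrD2l ltrN2.
pose x := x0 + t *: (z - x0).
have lx k' : l k' x = (1 - t) * l k' x0 + t * l k' z.
  by rewrite linearD linearZ linearB /=; ring.
have lxk : l k x = b k by rewrite lx /t; field; rewrite gt_eqF.
have lxk' k' : k' != k -> b k' < l k' x.
  move=> /lz' lz'k; have lx0' := base_interior k'.
  have -> : b k' = (1 - t) * b k' + t * b k' by ring.
  by rewrite lx ltr_leD ?ltr_pM2l ?ler_pM2l ?subr_gt0.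
exists x; split=> //; split.
  by apply/flatP; rewrite /x addrAC subrr add0r memvZ.
by move=> k'; have [->|/lxk'/ltW//] := eqVneq k' k; rewrite lxk.
Qed.

Lemma dim_tight_directions k : \dim U = (\dim (U :&: scalar_ker (l k))).+1.
Proof.
have [z [/flatP Uz lz _]] := irredundant k; apply: dim_cap_scalar_ker Uz _.
by rewrite linearB /= subr_eq0 lt_eqF // (lt_trans lz).
Qed.

Lemma tight_face_is_facet k : is_facet polyhedron (tight_face k).
Proof.
split; first exact: tight_face_is_face.
exists (\dim (U :&: scalar_ker (l k)))%:Z; split.
  by have [x [Px lx lx']] := exists_tight_only k; apply: has_dim_tight_face Px lx lx'.
rewrite -[_ + 1]/(_ + 1%:Z) -PoszD addn1 -dim_tight_directions.
exact: has_dim_interior polyhedron_base base_interior.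
Qed.

Lemma facet_is_tight_face F : is_facet polyhedron F -> exists k, F = tight_face k.
Proof.
move=> [faceF [d [dimF dimP]]]; have [|k Fk] := proper_face_sub_tight_face faceF.
  by move=> FP; rewrite FP in dimF; have := has_dim_unique dimF dimP; lia.
exists k; have [_ [d' [dim_k dimP']]] := tight_face_is_facet k.
apply: face_eq_dim faceF Fk _ dimF _; first by move=> x [].
by have -> : d = d' by have := has_dim_unique dimP dimP'; lia.
Qed.

Lemma tight_face_inj : injective tight_face.
Proof.
move=> k k' kk'; have [x [Px lx lx']] := exists_tight_only k.
have [_ /= lk'] : tight_face k' x by rewrite -kk'.
by apply/eqP; apply: contraT; rewrite eq_sym => /lx'; rewrite lk' ltxx.
Qed.

Lemma card_facets : ([set F | is_facet polyhedron F] #= `I_#|K|)%card.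
Proof.
have -> : [set F | is_facet polyhedron F]
          = [set tight_face (enum_val i) | i in [set: 'I_#|K|]].
  apply/seteqP; split=> [F /facet_is_tight_face[k ->]|_ [i _ <-]].
    by exists (enum_rank k) => //; rewrite enum_rankK.
  exact: tight_face_is_facet.
apply: card_eq_trans (inj_card_eq _) (card_esym card_II).
by move=> i j _ _ /tight_face_inj/enum_val_inj.
Qed.

End Polyhedron.

Section PartialSums.
Variable n : nat.

Definition psum (V : nmodType) (f : 'I_n -> V) (i : nat) : V :=
  \sum_(l < n | (l < i)%N) f l.

Section Nmodule.
Variable V : nmodType.
Implicit Types f g : 'I_n -> V.

Lemma psum0 f : psum f 0 = 0.
Proof. by rewrite /psum big_pred0. Qed.

Lemma eq_psum f g : f =1 g -> psum f =1 psum g.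
Proof. by move=> fg i; apply: eq_bigr. Qed.

Lemma psumS f (i : 'I_n) : psum f i.+1 = psum f i + f i.
Proof.
rewrite /psum (bigD1 i) //= addrC; congr (_ + _); apply: eq_bigl => l.
by rewrite -val_eqE /=; lia.
Qed.

Lemma psum_full f i : (n <= i)%N -> psum f i = \sum_l f l.
Proof. by move=> ni; apply: eq_bigl => l; rewrite (leq_trans _ ni). Qed.

Lemma psum_const (x : V) i : (i <= n)%N -> psum (fun=> x) i = x *+ i.
Proof. by move=> ni; rewrite /psum (big_ord_narrow ni) sumr_const card_ord. Qed.

End Nmodule.

Section Zmodule.
Variable V : zmodType.

Lemma psum_rev (f : 'I_n -> V) i :
  psum (fun l => f (rev_ord l)) i = \sum_l f l - psum f (n - i).
Proof.
apply/eqP; rewrite -subr_eq opprK; apply/eqP.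
rewrite [RHS](bigID (fun l : 'I_n => (l < n - i)%N)) /= addrC; congr (_ + _).
rewrite /psum (reindex_inj rev_ord_inj) /=; apply: eq_big => [l|l _].
  by have := ltn_ord l; lia.
by rewrite rev_ordK.
Qed.

Lemma psum_telescope (h : nat -> V) i : (i <= n)%N ->
  psum (fun l => h l.+1 - h l) i = h i - h 0%N.
Proof.
elim: i => [|i IH] lin; first by rewrite psum0 subrr.
by rewrite (psumS _ (Ordinal lin)) IH 1?ltnW //= addrC addrA subrK.
Qed.

End Zmodule.

Section Ordered.
Variable R : numDomainType.
Implicit Types f : 'I_n -> R.

Lemma psum_ge0 f i :
  (forall l : 'I_n, (l < i)%N -> 0 <= f l) -> 0 <= psum f i.
Proof. by move=> f0; apply: sumr_ge0. Qed.

Lemma psum_ge0_compensated f i (p q : 'I_n) : p != q -> (p < i)%N ->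
    (forall l, l != q -> 0 <= f l) -> 0 <= f p + f q ->
  0 <= psum f i.
Proof.
move=> pq pi f0 fpq; rewrite /psum (bigD1 p) //=.
have [qi|iq] := ltnP q i; last first.
  rewrite addr_ge0 ?f0 ?sumr_ge0 // => l /andP[li _]; apply: f0.
  by apply: contraTneq li => ->; rewrite -leqNgt.
rewrite (bigD1 q) /=; last by rewrite qi eq_sym.
by rewrite addrA addr_ge0 // sumr_ge0 // => l /andP[_ /f0].
Qed.

End Ordered.

End PartialSums.

Section AlternatingLines.
Variables (R : realType) (n : nat).
Implicit Types f : 'I_n -> R.

Definition asm_line f : Prop :=
  [/\ forall i, f i \in [:: 0; 1; -1], \sum_i f i = 1 & alternates f].

Lemma is_asm_lines (A : 'M[R]_n) : is_asm A <->
  (forall i, asm_line (A i)) /\ (forall j, asm_line (A^~ j)).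
Proof.
split=> [[A01 rA cA altr altc]|[rowA colA]]; first by split=> ?; split.
split=> [i|i|j|i|j]; first by case: (rowA i).
- by case: (rowA i).
- by case: (colA j).
- by case: (rowA i).
- by case: (colA j).
Qed.

Lemma alternates_opp f (j k : 'I_n) : (forall i, f i \in [:: 0; 1; -1]) ->
    alternates f -> (j < k)%N -> f j != 0 -> f k != 0 ->
    (forall l : 'I_n, (j < l < k)%N -> f l = 0) ->
  f k = - f j.
Proof.
have sg_id x : x \in [:: 0; 1; -1] -> Num.sg x = x :> R.
  by rewrite !inE => /or3P[] /eqP->; rewrite ?sgr0 ?sgr1 ?sgrN1.
by move=> f01 alt jk fj fk /(alt j k jk fj fk); rewrite !sg_id.
Qed.

(* The sum over [i <= l < j] is either zero or the last nonzero entry before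
   [j], which the next nonzero entry then cancels. *)
Lemma alternates_psum_diff f i j : (forall l, f l \in [:: 0; 1; -1]) ->
  alternates f -> (i <= j <= n)%N -> psum f j - psum f i \in [:: 0; 1; -1].
Proof.
move=> f01 alt.
suff inv : (i <= j <= n)%N -> psum f j - psum f i = 0 \/
    exists p : 'I_n, [/\ (p < j)%N, psum f j - psum f i = f p
                       & forall l : 'I_n, (p < l < j)%N -> f l = 0].
  by move=> /inv[->|[p [_ -> _]]] //; rewrite inE eqxx.
elim: j => [|j IH] /andP[ij jn].
  by left; move: ij; rewrite leqn0 => /eqP->; rewrite subrr.
move: ij; rewrite leq_eqVlt => /orP[/eqP->|ij]; first by left; rewrite subrr.
pose o := Ordinal jn; have := psumS f o => /= ->; rewrite addrAC.
have {IH} := IH; rewrite -ltnS ij (ltnW jn) => /(_ isT).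
have [fo0|fo_neq0] := eqVneq (f o) 0.
  rewrite fo0 addr0 => -[->|[p [pj -> zero]]]; [by left|right].
  exists p; split=> // [|l /andP[pl]]; first exact: ltnW.
  rewrite ltnS leq_eqVlt => /orP[/eqP lj|lj]; last by apply: zero; rewrite pl.
  by have -> : l = o by apply: val_inj.
case=> [->|[p [pj -> zero]]].
  by right; exists o; rewrite add0r; split=> // l /=; lia.
have [fp0|fp_neq0] := eqVneq (f p) 0.
  by right; exists o; rewrite fp0 add0r; split=> // l /=; lia.
by left; rewrite (@alternates_opp f p o) ?subrr.
Qed.

Lemma asm_line_psum f : asm_line f ->
  forall i, psum f i = 0 \/ psum f i = 1.
Proof.
move=> [f01 f1 alt] i; have [ni|/ltnW ni] := leqP n i.
  by right; rewrite psum_full.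
have := @alternates_psum_diff f 0 i f01 alt ni.
rewrite psum0 subr0 !inE => /or3P[] /eqP psum_i; [by left|by right|].
have := @alternates_psum_diff f i n f01 alt.
by rewrite ni leqnn psum_full // f1 psum_i !inE => /(_ isT)/or3P[] /eqP; lra.
Qed.

Lemma psum_asm_line f : (forall i, psum f i = 0 \/ psum f i = 1) ->
  \sum_i f i = 1 -> asm_line f.
Proof.
move=> f01 f1; have fE i : f i = psum f i.+1 - psum f i by rewrite psumS addrC addKr.
split=> // [i|j k jk fj fk zero].
  by rewrite fE; case: (f01 i) => ->; case: (f01 i.+1) => ->;
    rewrite ?subrr ?subr0 ?sub0r !inE eqxx ?orbT.
have psum_k : psum f k = psum f j.+1.
  rewrite /psum [LHS](bigID (fun l : 'I_n => (l < j.+1)%N)) /=.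
  rewrite [X in _ + X]big1 ?addr0 => [|l]; last first.
    by rewrite ltnS -ltnNge => /andP[lk jl]; apply: zero; rewrite jl.
  by apply: eq_bigl => l; lia.
move: fj fk; rewrite !fE psum_k.
by case: (f01 j) => ->; case: (f01 j.+1) => ->; case: (f01 k.+1) => ->;
  rewrite ?subrr ?eqxx // ?subr0 ?sub0r sgrN ?opprK.
Qed.

Lemma telescope_asm_line (h : nat -> R) f :
    (forall i, (i <= n)%N -> h i = 0 \/ h i = 1) -> h 0%N = 0 -> h n = 1 ->
    (forall i : 'I_n, f i = h i.+1 - h i) ->
  asm_line f.
Proof.
move=> h01 h0 hn fE; have psumE i : (i <= n)%N -> psum f i = h i.
  by move=> ni; rewrite (eq_psum fE) psum_telescope // h0 subr0.
have f1 : \sum_i f i = 1 by rewrite -(psum_full _ (leqnn n)) psumE.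
apply: psum_asm_line => // i; have [ni|/ltnW ni] := leqP n i.
  by right; rewrite psum_full.
by rewrite psumE //; apply: h01.
Qed.

End AlternatingLines.

Section Stretch.
Variable R : archiRealFieldType.
Implicit Types (x y m : R) (k : int).

Definition fractional x : R := x - (Num.floor x)%:~R.

Lemma fractional_ge0 x : 0 <= fractional x.
Proof. by rewrite subr_ge0 floor_le. Qed.

Lemma fractional_lt1 x : fractional x < 1.
Proof. by rewrite ltrBlDl; have := floorD1_gt x; rewrite intrD. Qed.

Lemma fractional_eq0 x : (fractional x == 0) = (x \is a Num.int).
Proof. by rewrite subr_eq0 eq_sym intrEfloor. Qed.

(* If [fractional x <= m], this is the average of [floor (x + t)] over
   [1 - m <= t < 1]. *)
Definition stretch m x : R := (Num.floor x)%:~R + fractional x / m.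

Lemma stretch_int m x : x \is a Num.int -> stretch m x = x.
Proof.
move=> x_int; rewrite /stretch (eqP (_ : fractional x == 0)) ?fractional_eq0 //.
by rewrite mul0r addr0 floorK.
Qed.

Lemma stretchDz m x k : stretch m (x + k%:~R) = stretch m x + k%:~R.
Proof.
rewrite /stretch /fractional floorDrz ?intr_int // intrKfloor intrD.
by rewrite opprD addrACA subrr addr0 addrAC.
Qed.

Lemma stretch_le m x y : 0 < m -> fractional x <= m -> x <= y ->
  stretch m x <= stretch m y.
Proof.
move=> m_gt0 xm xy; rewrite /stretch.
have [fxy|fxy] := leP (Num.floor y) (Num.floor x).
  have fE : Num.floor x = Num.floor y by apply/le_anti; rewrite fxy le_floor.
  by rewrite /fractional fE lerD2l ler_pM2r ?invr_gt0 // lerD2r.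
apply: (@le_trans _ _ ((Num.floor x)%:~R + 1)).
  by rewrite lerD2l ler_pdivrMr // mul1r.
apply: (@le_trans _ _ (Num.floor y)%:~R).
  by rewrite -[1]/(1%:~R) -intrD ler_int lezD1.
by rewrite lerDl divr_ge0 ?fractional_ge0 // ltW.
Qed.

End Stretch.

Section IntegerGaps.
Variables (R : archiRealFieldType) (T : Type).
Implicit Types (C D : T -> R) (p q : T).

Definition keeps_gaps C D : Prop :=
  forall p q (k : int), C p <= C q + k%:~R -> D p <= D q + k%:~R.

Lemma keeps_gaps_eq C D p q (k : int) : keeps_gaps C D ->
  C p = C q + k%:~R -> D p = D q + k%:~R.
Proof.
move=> CD E; apply/le_anti/andP; split; first by apply: CD; rewrite E.
by rewrite -lerBrDr -mulrNz; apply: CD; rewrite mulrNz E addrK.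
Qed.

Lemma keeps_gaps_01 C D p q : keeps_gaps C D ->
    (forall t, D t \is a Num.int) -> 0 <= C p - C q <= 1 ->
  D p - D q = 0 \/ D p - D q = 1.
Proof.
move=> CD D_int /andP[C0 C1].
have D0 : D q <= D p.
  by have := CD q p 0; rewrite !addr0 -subr_ge0 => /(_ C0).
have D1 : D p <= D q + 1 by apply: (CD p q 1); rewrite addrC -lerBlDr.
have /intrP[k Dpq] : D p - D q \is a Num.int by rewrite rpredB.
have /andP[k0 k1] : 0 <= k <= 1 by rewrite -(ler0z R) -(lerz1 R) -Dpq; lra.
have [k_eq|k_eq] : k = 0 \/ k = 1 by lia.
  by left; rewrite Dpq k_eq.
by right; rewrite Dpq k_eq.
Qed.

End IntegerGaps.

Section GapRounding.
Variables (R : realType) (T : finType).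
Implicit Types C D : {ffun T -> R^o}.

(* Write [m] for the largest fractional part. Then [C] is a convex combination of
   its floor and of [stretch m \o C], which has fewer nonintegral values. *)
Lemma gap_rounding_hull C :
  convex_hull [set D : {ffun T -> R^o} |
    (forall p, D p \is a Num.int) /\ keeps_gaps C D] C.
Proof.
have [s] := ubnP #|[pred p | C p \isn't a Num.int]|.
elim: s C => // s IH C; rewrite ltnS => card_C.
have [p0 /= Cp0|C_int] := pickP [pred p | C p \isn't a Num.int]; last first.
  by apply: subset_convex_hull; split=> // p; have /negbFE := C_int p.
have [q _ q_max] := arg_maxP (fun p => fractional (C p)) (isT : xpredT p0).
set m := fractional (C q) in q_max.
have m_gt0 : 0 < m.
  apply: lt_le_trans (q_max p0 isT).
  by rewrite lt_neqAle fractional_ge0 andbT eq_sym fractional_eq0.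
have m_lt1 : m < 1 := fractional_lt1 (C q).
pose Cfloor : {ffun T -> R^o} := [ffun p => (Num.floor (C p))%:~R].
pose Cstretch : {ffun T -> R^o} := [ffun p => stretch m (C p)].
have gaps_floor : keeps_gaps C Cfloor.
  move=> p q' k; rewrite !ffunE -intrD ler_int => /le_floor.
  by rewrite floorDrz ?intr_int // intrKfloor.
have gaps_stretch : keeps_gaps C Cstretch.
  move=> p q' k; rewrite !ffunE -stretchDz.
  by apply: stretch_le => //; apply: q_max.
have CE : C = (1 - m) *: Cfloor + (1 - (1 - m)) *: Cstretch.
  apply/ffunP => p; rewrite !ffunE /stretch /fractional /GRing.scale /=.
  by field; rewrite gt_eqF.
rewrite [X in convex_hull _ X]CE; apply: convex_hull_convex; first by lra.
  by apply: subset_convex_hull; split=> // p; rewrite ffunE intr_int.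
suff /IH : (#|[pred p | Cstretch p \isn't a Num.int]| < s)%N.
  apply: (@convex_hull_image _ _ _ _ _ idfun) => D [D_int CD].
  by split=> // p q' k Cpq; apply/CD/gaps_stretch.
apply: leq_trans card_C; apply: proper_card; apply/properP; split.
  apply/fintype.subsetP => p; rewrite !inE ffunE; apply: contra => Cp.
  by rewrite stretch_int.
exists q; rewrite !inE; first by rewrite -fractional_eq0 gt_eqF.
by rewrite negbK ffunE /stretch -/m divff ?gt_eqF // rpredD ?intr_int ?rpred1.
Qed.

End GapRounding.

Section Rotation.
Variables (T : Type) (n : nat).
Implicit Types A : 'M[T]_n.

Definition mxrot A : 'M[T]_n := \matrix_(i, j) A j (rev_ord i).

Lemma mxrot2E A i j : iter 2 mxrot A i j = A (rev_ord i) (rev_ord j).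
Proof. by rewrite /= !mxE. Qed.

Lemma mxrot3E A i j : iter 3 mxrot A i j = A (rev_ord j) i.
Proof. by rewrite iterS mxE mxrot2E rev_ordK. Qed.

Lemma mxrot4 A : iter 4 mxrot A = A.
Proof. by apply/matrixP => i j; rewrite iterS mxE mxrot3E rev_ordK. Qed.

Lemma iter_mxrot_mod4 A g : iter g mxrot A = iter (g %% 4) mxrot A.
Proof.
rewrite {1}(divn_eq g 4) addnC iterD; congr (iter _ _ _).
by elim: (g %/ 4)%N => // k IH; rewrite mulSn addnC iterD mxrot4.
Qed.

Lemma iter_mxrot_const g (a : T) : iter g mxrot (const_mx a) = const_mx a.
Proof. by elim: g => //= g ->; apply/matrixP => i j; rewrite !mxE. Qed.

End Rotation.

Arguments mxrot {T n} A.

Section UnitSums.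
Variables (R : pzSemiRingType) (n : nat).
Implicit Types A : 'M[R]_n.

Definition unit_sums A : Prop :=
  (forall r, \sum_c A r c = 1) /\ (forall c, \sum_r A r c = 1).

Lemma unit_sums_mxrot A : unit_sums A -> unit_sums (mxrot A).
Proof.
move=> [rA cA]; split=> r.
  by under eq_bigr do rewrite mxE; rewrite cA.
under eq_bigr do rewrite mxE.
by rewrite -[RHS](rA r) [RHS](reindex_inj rev_ord_inj).
Qed.

Lemma unit_sums_iter_mxrot g A : unit_sums A -> unit_sums (iter g mxrot A).
Proof. by move=> uA; elim: g => //= g; apply: unit_sums_mxrot. Qed.

End UnitSums.

Section CornerSums.
Variables (R : realType) (n : nat).
Implicit Types A : 'M[R]_n.

Definition psums_in_01 A : Prop :=
  (forall r j, 0 <= psum (A r) j <= 1) /\ (forall c i, 0 <= psum (A^~ c) i <= 1).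

Lemma asm_unit_sums A : is_asm A -> unit_sums A.
Proof. by case. Qed.

Lemma asm_psums_in_01 A : is_asm A -> psums_in_01 A.
Proof.
have line_01 (f : 'I_n -> R) : asm_line f -> forall i, 0 <= psum f i <= 1.
  by move=> /asm_line_psum f01 i; case: (f01 i) => ->; rewrite ?lexx ?ler01.
by move=> /is_asm_lines[rowA colA]; split=> ? ?; apply: line_01.
Qed.

Definition corner_sum A (i j : nat) : R := psum (fun c => psum (A^~ c) i) j.

Lemma corner_sumE A i j : corner_sum A i j = psum (fun r => psum (A r) j) i.
Proof. by rewrite /corner_sum /psum exchange_big. Qed.

Lemma corner_sumSr A i (c : 'I_n) :
  corner_sum A i c.+1 = corner_sum A i c + psum (A^~ c) i.
Proof. exact: psumS. Qed.

Lemma corner_sumSl A (r : 'I_n) j :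
  corner_sum A r.+1 j = corner_sum A r j + psum (A r) j.
Proof. by rewrite !corner_sumE psumS. Qed.

Local Notation nodes := ('I_n.+1 * 'I_n.+1)%type.
Local Notation grid := {ffun nodes -> R^o}.

Definition corner_grid A : grid := [ffun p : nodes => corner_sum A p.1 p.2].

Definition corner_diff (D : grid) : 'M[R]_n :=
  let d i j : R := D (inord i, inord j) in
  \matrix_(r, c) (d r.+1 c.+1 - d r c.+1 - (d r.+1 c - d r c)).

Fact corner_diff_is_linear : linear corner_diff.
Proof.
by move=> a C D; apply/matrixP => r c; rewrite !mxE !ffunE /GRing.scale /=; ring.
Qed.

HB.instance Definition _ :=
  GRing.isLinear.Build R grid 'M[R]_n *:%R corner_diff corner_diff_is_linear.

Lemma corner_gridE A i j : (i <= n)%N -> (j <= n)%N ->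
  corner_grid A (inord i, inord j) = corner_sum A i j.
Proof. by move=> ni nj; rewrite ffunE /= !inordK. Qed.

Lemma corner_gridK A : corner_diff (corner_grid A) = A.
Proof.
apply/matrixP => r c; have [rn cn] := (ltnW (ltn_ord r), ltnW (ltn_ord c)).
rewrite mxE !corner_gridE //.
by rewrite !corner_sumSl psumS; ring.
Qed.

Lemma corner_diff_asm A (D : grid) : unit_sums A -> psums_in_01 A ->
    (forall p, D p \is a Num.int) -> keeps_gaps (corner_grid A) D ->
  is_asm (corner_diff D).
Proof.
move=> [rA cA] [rowA colA] D_int AD; apply/is_asm_lines.
have gap01 p q : 0 <= corner_grid A p - corner_grid A q <= 1 ->
    D p - D q = 0 \/ D p - D q = 1 by apply: keeps_gaps_01.
have gap_eq p q (k : nat) : corner_grid A p = corner_grid A q + k%:R ->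
    D p - D q = k%:R.
  by move=> /(keeps_gaps_eq (k := k%:Z) AD) ->; rewrite addrC addKr.
pose d i j : R := D (inord i, inord j).
split=> [r|c].
  have rn := ltnW (ltn_ord r).
  apply: (telescope_asm_line (h := fun j => d r.+1 j - d r j)) => [j nj|||c].
  - by apply: gap01; rewrite !corner_gridE // corner_sumSl addrC addKr.
  - by apply: (gap_eq _ _ 0%N); rewrite !corner_gridE // corner_sumSl psum0.
  - by apply: (gap_eq _ _ 1%N); rewrite !corner_gridE // corner_sumSl psum_full ?rA.
  - by rewrite mxE.
have cn := ltnW (ltn_ord c).
apply: (telescope_asm_line (h := fun i => d i c.+1 - d i c)) => [i ni|||r].
- by apply: gap01; rewrite !corner_gridE // corner_sumSr addrC addKr.
- by apply: (gap_eq _ _ 0%N); rewrite !corner_gridE // corner_sumSr psum0.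
- by apply: (gap_eq _ _ 1%N); rewrite !corner_gridE // corner_sumSr psum_full ?cA.
- by rewrite mxE /d /=; ring.
Qed.

Lemma asm_polytope_psums A : unit_sums A -> psums_in_01 A -> asm_polytope R n A.
Proof.
move=> uA pA; rewrite -[A]corner_gridK.
by apply: convex_hull_image (gap_rounding_hull _) => D []; apply: corner_diff_asm.
Qed.

End CornerSums.

Section Sides.
Variables (R : realType) (n : nat).
Implicit Types A : 'M[R]_n.

Lemma iter_mxrot_linear g (a : R) A B :
  iter g mxrot (a *: A + B) = a *: iter g mxrot A + iter g mxrot B.
Proof. by elim: g => //= g ->; apply/matrixP => i j; rewrite !mxE. Qed.

(* Sum of the first [i] entries of a line, read from the top, right, bottom or left
   border according to [g] modulo 4; the line is column [j] of the rotated matrix. *)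
Definition side g A (j : 'I_n) i : R := psum ((iter g mxrot A)^~ j) i.

Lemma side_linear g j i (a : R) A B :
  side g (a *: A + B) j i = a * side g A j i + side g B j i.
Proof.
rewrite /side iter_mxrot_linear /psum mulr_sumr -big_split /=.
by apply: eq_bigr => r _; rewrite !mxE.
Qed.

Lemma side_const g (a : R) j i : (i <= n)%N -> side g (const_mx a) j i = a *+ i.
Proof.
move=> ni; rewrite /side iter_mxrot_const -(psum_const a ni).
by apply: eq_psum => r; rewrite mxE.
Qed.

Lemma side_mod4 g A j i : side g A j i = side (g %% 4) A j i.
Proof. by rewrite /side iter_mxrot_mod4. Qed.

Lemma side_iter g h A j i : side g (iter h mxrot A) j i = side (g + h) A j i.
Proof. by rewrite /side iterD. Qed.

Lemma side1E A j i : side 1 A j i = psum (fun r => A j (rev_ord r)) i.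
Proof. by apply: eq_psum => r; rewrite mxE. Qed.

Lemma side2E A j i : side 2 A j i = psum (fun r => A (rev_ord r) (rev_ord j)) i.
Proof. by apply: eq_psum => r; rewrite mxrot2E. Qed.

Lemma side3E A j i : side 3 A j i = psum (A (rev_ord j)) i.
Proof. by apply: eq_psum => r; rewrite mxrot3E. Qed.

Lemma side1_compl A j i : unit_sums A -> side 1 A j i = 1 - psum (A j) (n - i).
Proof. by move=> [rA _]; rewrite side1E psum_rev rA. Qed.

Lemma side2_compl A j i : unit_sums A ->
  side 2 A j i = 1 - psum (A^~ (rev_ord j)) (n - i).
Proof. by move=> [_ cA]; rewrite side2E (psum_rev (A^~ (rev_ord j))) cA. Qed.

Lemma sides_ge0_psums A : unit_sums A ->
  (forall g j i, 0 <= side g A j i) <-> psums_in_01 A.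
Proof.
move=> uA; split=> [sA|[rowA colA] g j i].
  have psum_min (f : 'I_n -> R) i : psum f i = psum f (n - (n - i)).
    by apply: eq_bigl => l; have := ltn_ord l; lia.
  split=> [r j|c i]; apply/andP; split.
  - by have := sA 3%N (rev_ord r) j; rewrite side3E rev_ordK.
  - by rewrite psum_min -subr_ge0 -side1_compl.
  - exact: (sA 0%N c i).
  - by rewrite psum_min -subr_ge0 -[c]rev_ordK -side2_compl.
rewrite side_mod4; have := ltn_pmod g (isT : 0 < 4)%N.
case: (g %% 4)%N => [|[|[|[|//]]]] _.
- by have /andP[] := colA j i.
- by rewrite side1_compl // subr_ge0; have /andP[] := rowA j (n - i)%N.
- by rewrite side2_compl // subr_ge0; have /andP[] := colA (rev_ord j) (n - i)%N.
- by rewrite side3E; have /andP[] := rowA (rev_ord j) i.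
Qed.

End Sides.

Section ZeroSums.
Variables (F : fieldType) (n : nat).

Definition zero_sums : {vspace 'M[F]_n} :=
  (lker (linfun (mulmxr (const_mx 1 : 'cV[F]_n))) :&:
   lker (linfun (mulmx (const_mx 1 : 'rV[F]_n))))%VS.

Lemma mem_zero_sums (A : 'M[F]_n) : A \in zero_sums <->
  (forall r, \sum_c A r c = 0) /\ (forall c, \sum_r A r c = 0).
Proof.
have rowE r : (A *m (const_mx 1 : 'cV_n)) r ord0 = \sum_c A r c.
  by rewrite mxE; apply: eq_bigr => c _; rewrite mxE mulr1.
have colE c : ((const_mx 1 : 'rV_n) *m A) ord0 c = \sum_r A r c.
  by rewrite mxE; apply: eq_bigr => r _; rewrite mxE mul1r.
rewrite memv_cap !memv_ker !lfunE /=; split=> [/andP[/eqP rA /eqP cA]|[rA cA]].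
  by split=> i; rewrite -?rowE -?colE ?rA ?cA mxE.
by apply/andP; split; apply/eqP/matrixP => i j;
  rewrite ?[i]ord1 ?[j]ord1 ?rowE ?colE ?rA ?cA mxE.
Qed.

End ZeroSums.

Lemma flat_zero_sums (R : realType) n (A B : 'M[R]_n) :
  unit_sums A -> flat A (zero_sums R n) B <-> unit_sums B.
Proof.
move=> [rA cA]; rewrite flatP mem_zero_sums.
have rowE r : \sum_c B r c = \sum_c (B - A) r c + 1.
  by rewrite -(rA r) -big_split; apply: eq_bigr => c _; rewrite !mxE /= subrK.
have colE c : \sum_r B r c = \sum_r (B - A) r c + 1.
  by rewrite -(cA c) -big_split; apply: eq_bigr => r _; rewrite !mxE /= subrK.
split=> -[rB cB]; split=> i.
- by rewrite rowE rB add0r.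
- by rewrite colE cB add0r.
- by apply: (addIr 1); rewrite -rowE rB add0r.
- by apply: (addIr 1); rewrite -colE cB add0r.
Qed.

Section FillColumn.
Variables (R : numFieldType) (n : nat).

Definition fill_col (p : 'I_n.+2 -> R) (j : 'I_n.+2) : 'M[R]_n.+2 :=
  \matrix_(r, c) if c == j then p r else (1 - p r) / n.+1%:R.

Lemma unit_sums_fill_col p j : \sum_r p r = 1 -> unit_sums (fill_col p j).
Proof.
move=> p1; split=> [r|c].
  rewrite (bigD1 j) //= mxE eqxx.
  under eq_bigr => c cj do rewrite mxE (negbTE cj).
  rewrite sumr_const cardC1 card_ord -[_ *+ _]mulr_natr divfK ?pnatr_eq0 //.
  by rewrite addrC subrK.
have [->|cj] := eqVneq c j; first by under eq_bigr do rewrite mxE eqxx.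
under eq_bigr do rewrite mxE (negbTE cj).
rewrite -mulr_suml sumrB p1 sumr_const card_ord [1 *+ n.+2]mulrS.
by rewrite addrAC subrr add0r mulfV // pnatr_eq0.
Qed.

End FillColumn.

(* [None] stands for the top left corner entry, [Some (i, j)] for the top [i.+1]
   entries of the inner column [j.+1]; the other three sides follow by rotation. *)
Local Notation seg m := (option ('I_m * 'I_m)).

Section Segments.
Variable m : nat.
Implicit Type o : seg m.

Definition seg_line o : 'I_m.+2 :=
  if o is Some (_, j) then lift ord0 (lift ord_max j) else ord0.

Definition seg_len o : nat := if o is Some (i, _) then i.+1 else 1.

Lemma seg_line_le o : (seg_line o <= m)%N.
Proof. by case: o => [[i j]|//]; rewrite /seg_line lift0 lift_max. Qed.

Lemma seg_line_eq0 o : seg_line o = ord0 -> o = None.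
Proof. by case: o => [[i j]|] // /(congr1 val). Qed.

Lemma seg_len_gt0 o : (0 < seg_len o)%N.
Proof. by case: o => [[]|]. Qed.

Lemma seg_len_le o : (0 < m)%N -> (seg_len o <= m)%N.
Proof. by case: o => [[i j]|] //= _. Qed.

Lemma seg_inj o o' : seg_line o = seg_line o' -> seg_len o = seg_len o' -> o = o'.
Proof.
case: o o' => [[i j]|] [[i' j']|] //= /lift_inj/lift_inj-> [ii'].
by congr (Some (_, _)); apply: val_inj.
Qed.

Lemma seg_surj (c : 'I_m.+2) i : (0 < c <= m)%N -> (0 < i <= m)%N ->
  exists2 o, seg_line o = c & seg_len o = i.
Proof.
case: c i => [[|c] cn] [|i] //= cm im; exists (Some (Ordinal im, Ordinal cm)) => //.
by apply: val_inj; rewrite [LHS]lift0 lift_max.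
Qed.

End Segments.

Section SegmentInequalities.
Variables (R : realType) (m : nat).
Local Notation n := m.+2.
Implicit Types (A : 'M[R]_n) (o : seg m).

Definition segs_ge0 A : Prop := forall g o, 0 <= side g A (seg_line o) (seg_len o).

Lemma segs_ge0_iter_mxrot g A : segs_ge0 A -> segs_ge0 (iter g mxrot A).
Proof. by move=> sA h o; rewrite side_iter. Qed.

Lemma top_row_ge0 A (c : 'I_n) : segs_ge0 A -> 0 <= A ord0 c.
Proof.
move=> sA; have side_1 g j : side g A j 1 = iter g mxrot A ord0 j.
  by rewrite /side (psumS _ (ord0 : 'I_n)) psum0 add0r.
have [c0|c_gt0] := posnP c.
  have -> : c = ord0 by apply: val_inj.
  by have := sA 0%N None; rewrite side_1.
have [cm|mc] := leqP c m.
  have [||o <- oi] := @seg_surj m c 1; first by rewrite c_gt0.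
    exact: leq_trans c_gt0 cm.
  by have := sA 0%N o; rewrite oi side_1.
have -> : c = rev_ord ord0 by apply: val_inj => /=; have := ltn_ord c; lia.
by have := sA 1%N None; rewrite side_1 /= mxE.
Qed.

Lemma border_ge0 g A (c : 'I_n) : segs_ge0 A -> 0 <= iter g mxrot A ord0 c.
Proof. by move=> sA; apply/top_row_ge0/segs_ge0_iter_mxrot. Qed.

Lemma top_side_ge0 A (c : 'I_n) i : unit_sums A -> segs_ge0 A -> 0 <= side 0 A c i.
Proof.
move=> [rA cA] sA; have border g j := border_ge0 g j sA.
have [c0|c_gt0] := posnP c.
  have -> : c = ord0 by apply: val_inj.
  by apply: psum_ge0 => r _; have := border 3%N (rev_ord r); rewrite mxrot3E rev_ordK.
have [cm|mc] := leqP c m; last first.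
  have -> : c = rev_ord ord0 by apply: val_inj => /=; have := ltn_ord c; lia.
  by apply: psum_ge0 => r _; have := border 1%N r; rewrite /= mxE.
have [->|i_gt0] := posnP i; first by rewrite /side psum0.
have [im|mi] := leqP i m.
  have [||o <- <-] := @seg_surj m c i; [by rewrite c_gt0|by rewrite i_gt0|exact: sA].
have [ni|] := leqP n i; first by rewrite /side psum_full // cA.
rewrite ltnS => im; have -> : i = (ord_max : 'I_n) by apply/eqP; rewrite eqn_leq im.
have -> : side 0 A c (ord_max : 'I_n) = 1 - A ord_max c.
  by rewrite -(cA c) -(psum_full _ (leqnn n)) (psumS _ ord_max) addrK.
rewrite subr_ge0 -(rA ord_max) (bigD1 c) //= lerDl sumr_ge0 // => j _.
have := border 2%N (rev_ord j); rewrite mxrot2E rev_ordK.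
by have -> : rev_ord ord0 = ord_max :> 'I_n by apply: val_inj => /=; lia.
Qed.

Lemma sides_ge0_segs A : unit_sums A ->
  (forall g j i, 0 <= side g A j i) <-> segs_ge0 A.
Proof.
move=> uA; split=> [sA g o|sA g j i]; first exact: sA.
rewrite -[g]add0n -side_iter; apply: top_side_ge0.
  exact: unit_sums_iter_mxrot.
exact: segs_ge0_iter_mxrot.
Qed.

Definition seg_sum (k : 'I_4 * seg m) A : R :=
  side k.1 A (seg_line k.2) (seg_len k.2).

Fact seg_sum_is_linear k : linear_for *%R (seg_sum k).
Proof. by move=> a A B; rewrite /seg_sum side_linear. Qed.

HB.instance Definition _ k :=
  GRing.isLinear.Build R 'M[R]_n R *%R (seg_sum k) (seg_sum_is_linear k).

Lemma segs_ge0P A : segs_ge0 A <-> forall k, 0 <= seg_sum k A.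
Proof.
split=> [sA k|sA g o]; first exact: sA.
by rewrite side_mod4; apply: (sA (Ordinal (ltn_pmod g (isT : 0 < 4)%N), o)).
Qed.

Definition uniform_mx : 'M[R]_n := const_mx n%:R^-1.

Lemma unit_sums_uniform_mx : unit_sums uniform_mx.
Proof.
have sum1 : \sum_(i < n) n%:R^-1 = 1 :> R.
  by rewrite sumr_const card_ord -[_ *+ _]mulr_natr mulVf // pnatr_eq0.
by split=> i; under eq_bigr do rewrite mxE.
Qed.

Lemma asm_polytope_polyhedron :
  asm_polytope R n = polyhedron uniform_mx (zero_sums R n) seg_sum (fun=> 0).
Proof.
apply/seteqP; split=> [|A [/(flat_zero_sums _ unit_sums_uniform_mx) uA /segs_ge0P]].
  apply: convex_hull_polyhedron => A asmA; have uA := asm_unit_sums asmA.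
  split; first exact/(flat_zero_sums _ unit_sums_uniform_mx).
  by apply/segs_ge0P/(sides_ge0_segs uA)/(sides_ge0_psums uA)/asm_psums_in_01.
by move=> /(sides_ge0_segs uA)/(sides_ge0_psums uA); apply: asm_polytope_psums.
Qed.

Lemma seg_sum_uniform_mx_gt0 k : 0 < seg_sum k uniform_mx.
Proof.
have len_le : (seg_len k.2 <= n)%N by case: k.2 => [[i j]|] //=; have := ltn_ord i; lia.
by rewrite /seg_sum side_const // pmulrn_lgt0 ?seg_len_gt0 // invr_gt0 ltr0n.
Qed.

End SegmentInequalities.

Section Violators.
Variables (R : realType) (m : nat).
Local Notation n := m.+2.
Hypothesis m_gt0 : (0 < m)%N.

Section OneSegment.
Variable o : seg m.

Let j : 'I_n := seg_line o.
Let end_row : 'I_n := inord (seg_len o).-1.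
Let next_row : 'I_n := inord (seg_len o).
Let eps : R := m.+1%:R^-1.

Definition violator_col (r : 'I_n) : R :=
  (r == ord_max)%:R + eps * ((r == next_row)%:R - (r == end_row)%:R).

(* Its only negative entry is the last one of the segment [o]; every other segment
   through that entry meets another entry that compensates for it. *)
Definition violator : 'M[R]_n := fill_col violator_col j.

Let eps_gt0 : 0 < eps.
Proof. by rewrite invr_gt0 ltr0n. Qed.

Let eps_le1 : eps <= 1.
Proof. by rewrite invf_le1 ?ltr0n // ler1n. Qed.

Let end_rowE : end_row.+1 = seg_len o.
Proof.
have := seg_len_le o m_gt0; have := seg_len_gt0 o => len_gt0 len_le.
by rewrite inordK prednK //; lia.
Qed.

Let next_rowE : next_row = seg_len o :> nat.
Proof. by rewrite inordK //; have := seg_len_le o m_gt0; lia. Qed.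

Let end_neq_next : end_row != next_row.
Proof. by rewrite -val_eqE /= next_rowE -end_rowE; lia. Qed.

Let rows_neq_max : (end_row != ord_max) /\ (next_row != ord_max).
Proof.
have := seg_len_le o m_gt0.
by rewrite -!val_eqE /= next_rowE -end_rowE => len_le; split; lia.
Qed.

Lemma violator_unit_sums : unit_sums violator.
Proof.
have delta (k : 'I_n) : \sum_r (r == k)%:R = 1 :> R.
  by rewrite (bigD1 k) //= eqxx big1 ?addr0 // => r /negbTE->.
apply: unit_sums_fill_col; rewrite big_split -mulr_sumr sumrB /= !delta.
by rewrite subrr mulr0 addr0.
Qed.

Lemma violator_end_rowE : violator end_row j = - eps.
Proof.
have [/negbTE end_max _] := rows_neq_max.
by rewrite mxE /violator_col !eqxx end_max (negbTE end_neq_next) /=; ring.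
Qed.

Lemma violator_next_rowE : violator next_row j = eps.
Proof.
have [_ /negbTE next_max] := rows_neq_max.
by rewrite mxE /violator_col !eqxx next_max eq_sym (negbTE end_neq_next) /=; ring.
Qed.

Lemma violator_last_rowE : violator ord_max j = 1.
Proof.
have [end_max next_max] := rows_neq_max.
rewrite mxE /violator_col !eqxx [_ == next_row]eq_sym [_ == end_row]eq_sym.
by rewrite (negbTE end_max) (negbTE next_max) /=; ring.
Qed.

Lemma violator_above_eq0 (r : 'I_n) : (r < end_row)%N -> violator r j = 0.
Proof.
move=> r_end; rewrite mxE /violator_col eqxx.
have [-> -> ->] :
    [/\ (r == ord_max) = false, (r == next_row) = false & (r == end_row) = false].
  have end_lt := ltn_ord end_row.
  by rewrite -!val_eqE /= next_rowE -end_rowE; split; lia.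
by rewrite /=; ring.
Qed.

Lemma violator_col_le1 (r : 'I_n) : violator_col r <= 1.
Proof.
have [_ /negbTE next_max] := rows_neq_max; have := eps_gt0; have := eps_le1.
rewrite /violator_col; have [->|_] := eqVneq r ord_max.
  by rewrite [_ == next_row]eq_sym next_max; case: (_ == end_row) => /=; lra.
by case: (_ == next_row); case: (_ == end_row) => /=; lra.
Qed.

Lemma violator_ge0 (r c : 'I_n) : r != end_row \/ c != j -> 0 <= violator r c.
Proof.
rewrite mxE; have [_ [/negbTE r_end|//]|_ _] := eqVneq c j; last first.
  by rewrite divr_ge0 // subr_ge0 violator_col_le1.
by rewrite /violator_col r_end subr0 addr_ge0 ?mulr_ge0 ?ler0n ?(ltW eps_gt0).
Qed.

Lemma violator_end_row_ge (c : 'I_n) : c != j -> eps <= violator end_row c.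
Proof.
have [/negbTE end_max _] := rows_neq_max => /negbTE cj.
rewrite mxE cj /violator_col end_max (negbTE end_neq_next) eqxx -/eps /=.
by rewrite ler_peMl ?(ltW eps_gt0) //; have := eps_gt0; lra.
Qed.

Lemma violator_seg_lt0 : side 0 violator (seg_line o) (seg_len o) < 0.
Proof.
rewrite -end_rowE /side psumS /= -/j violator_end_rowE /psum big1 ?add0r ?oppr_lt0 //.
by move=> r /violator_above_eq0.
Qed.

Lemma violator_top_ge0 o' :
  o' != o -> 0 <= side 0 violator (seg_line o') (seg_len o').
Proof.
move=> oo'; have [jj|jj] := eqVneq (seg_line o') j; last first.
  by apply: psum_ge0 => r _; apply: violator_ge0; right.
have [len_lt|len_gt|len_eq] := ltngtP (seg_len o') (seg_len o).
- apply: psum_ge0 => r r_lt; apply: violator_ge0; left.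
  by rewrite -val_eqE /=; lia.
- apply: (psum_ge0_compensated (p := next_row) (q := end_row)); rewrite /= ?jj.
  + by rewrite eq_sym.
  + by rewrite next_rowE.
  + by move=> r r_end; apply: violator_ge0; left.
  + by rewrite violator_next_rowE violator_end_rowE subrr.
- by case/eqP: oo'; apply: seg_inj.
Qed.

Lemma violator_bottom_ge0 o' : 0 <= side 2 violator (seg_line o') (seg_len o').
Proof.
rewrite side2E; have [jj|jj] := eqVneq (rev_ord (seg_line o')) j; last first.
  by apply: psum_ge0 => r _; apply: violator_ge0; right.
have rev_max : rev_ord ord0 = ord_max :> 'I_n by apply: val_inj => /=; lia.
apply: (psum_ge0_compensated (p := ord0) (q := rev_ord end_row)).
- by rewrite -(inj_eq rev_ord_inj) rev_ordK rev_max eq_sym; case: rows_neq_max.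
- exact: seg_len_gt0.
- move=> r r_end; apply: violator_ge0; left.
  by apply: contra r_end => /eqP <-; rewrite rev_ordK.
- by rewrite jj rev_max rev_ordK violator_last_rowE violator_end_rowE subr_ge0.
Qed.

Lemma violator_right_ge0 o' : 0 <= side 1 violator (seg_line o') (seg_len o').
Proof.
rewrite side1E; have [ll|ll] := eqVneq (seg_line o') end_row; last first.
  by apply: psum_ge0 => r _; apply: violator_ge0; left.
have j_le : (j <= m)%N := seg_line_le o.
have rev0_j : rev_ord ord0 != j by rewrite -val_eqE /=; lia.
apply: (psum_ge0_compensated (p := ord0) (q := rev_ord j)).
- by rewrite -(inj_eq rev_ord_inj) rev_ordK.
- exact: seg_len_gt0.
- move=> r r_j; apply: violator_ge0; right.
  by apply: contra r_j => /eqP <-; rewrite rev_ordK.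
- by rewrite ll rev_ordK violator_end_rowE subr_ge0 violator_end_row_ge.
Qed.

Lemma violator_left_ge0 o' : 0 <= side 3 violator (seg_line o') (seg_len o').
Proof.
rewrite side3E; have [ll|ll] := eqVneq (rev_ord (seg_line o')) end_row; last first.
  by apply: psum_ge0 => r _; apply: violator_ge0; left.
have j_neq0 : ord0 != j.
  apply/eqP => /esym/seg_line_eq0 o_corner; move: ll (seg_line_le o') end_rowE.
  by rewrite o_corner => /(congr1 val) /=; lia.
apply: (psum_ge0_compensated (p := ord0) (q := j)) => //.
- exact: seg_len_gt0.
- by move=> r r_j; apply: violator_ge0; right.
- by rewrite ll violator_end_rowE subr_ge0 violator_end_row_ge.
Qed.

Lemma violator_side_ge0 (g : 'I_4) o' : (g, o') != (ord0, o) ->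
  0 <= side g violator (seg_line o') (seg_len o').
Proof.
case: g => [[|[|[|[|//]]]] g_lt] go /=.
- apply: violator_top_ge0; apply: contra go => /eqP->.
  by rewrite xpair_eqE eqxx andbT.
- exact: violator_right_ge0.
- exact: violator_bottom_ge0.
- exact: violator_left_ge0.
Qed.

End OneSegment.

Lemma seg_sum_irredundant (k : 'I_4 * seg m) :
  exists A : 'M[R]_n, [/\ unit_sums A, seg_sum k A < 0
                        & forall k', k' != k -> 0 <= seg_sum k' A].
Proof.
case: k => g o; exists (iter (4 - g) mxrot (violator o)); split.
- exact/unit_sums_iter_mxrot/violator_unit_sums.
- by rewrite /seg_sum side_iter subnKC 1?ltnW // side_mod4 violator_seg_lt0.
- move=> [g' o'] neq; rewrite /seg_sum side_iter side_mod4 /=.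
  apply: (violator_side_ge0 (g := Ordinal (ltn_pmod _ (isT : 0 < 4)%N))).
  apply: contra neq => /eqP[g0 ->]; rewrite xpair_eqE eqxx andbT -val_eqE /=.
  by have := ltn_ord g; have := ltn_ord g'; lia.
Qed.

Lemma card_asm_facets :
  ([set F | is_facet (asm_polytope R n) F] #= `I_(4 * (m ^ 2 + 1)))%card.
Proof.
have <- : #|{: 'I_4 * seg m}| = (4 * (m ^ 2 + 1))%N.
  by rewrite card_prod card_option card_prod !card_ord -mulnn addn1.
rewrite asm_polytope_polyhedron; apply: card_facets => [|k|k].
- by apply/card_gt0P; exists (ord0, None).
- exact: seg_sum_uniform_mx_gt0.
- have [A [uA sA sA']] := seg_sum_irredundant k; exists A; split=> //.
  exact/(flat_zero_sums _ (unit_sums_uniform_mx R m)).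
Qed.

End Violators.

Local Open Scope card_scope.

Theorem theorem3p3 (R : realType) (n : nat) (hn : (3 <= n)%N) :
  [set F : set 'M[R]_n | is_facet (asm_polytope R n) F]
    #= `I_(4 * ((n - 2) ^ 2 + 1))%N.
Proof.
case: n hn => [|[|m]] // m_gt0.
by rewrite !subSS subn0; apply: card_asm_facets.
Qed.
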